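(* If $\Gamma$ is a graph arising as a regular tiling of the hyperbolic plane, then $\mathsf{wCop}(\Gamma)=\infty$.
   Context: Graphs are undirected, without double edges and without loops. A graph arising as a regular tiling of the hyperbolic plane is the graph of vertices and edges of a tiling of the hyperbolic plane by congruent regular (compact) $p$-gons with $q$ of them meeting at each vertex (for integers $p,q\ge3$ with $\frac1p+\frac1q<\frac12$). For a connected graph $\Gamma$, $\mathsf{dist}$ is the path distance on $V(\Gamma)$. Game. The cops and robber game on a connected graph $\Gamma$ has parameters: number of cops $n$, cop speed $\sigma$, cop reach $\rho$, robber speed $\psi$, a vertex $v$, and a positive integer $R$. It is a perfect information game. First the $n$ cops choose initial vertices $c^1_0,\dots,c^n_0$; then, knowing these, the robber chooses an initial vertex $r_0$. In stage $k\ge 1$ each cop moves from $c^i_{k-1}$ to a vertex $c^i_k$ with $\mathsf{dist}(c^i_{k-1},c^i_k)\le\sigma$. The robber is captured during stage $k$ if $\mathsf{dist}(r_{k-1},c^i_k)\le\rho$ for some $i$. If not captured, the robber moves from $r_{k-1}$ to a vertex $r_k$ such that there is a path from $r_{k-1}$ to $r_k$ of length at most $\psi$ all of whose vertices are at distance larger than $\rho$ from every $c^i_k$. The cops win (protect the $R$-ball centered at $v$) if the robber is captured at some stage or there is $N>0$ such that $\mathsf{dist}(v,r_k)>R$ for all $k\ge N$. $\Gamma$ is $\mathsf{CopWin}(n,\sigma,\rho,\psi,R)$ if for every vertex $v$ of $\Gamma$ the $n$ cops have a winning strategy in the game with parameters $n,\sigma,\rho,\psi,v,R$. $\Gamma$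 is $n$-weak cop win if $\exists\,\sigma\in\mathbb{Z}_{>0}\ \exists\,\rho\in\mathbb{Z}_{\ge0}\ \forall\,\psi,R\in\mathbb{Z}_{>0}$: $\Gamma$ is $\mathsf{CopWin}(n,\sigma,\rho,\psi,R)$. The weak cop number $\mathsf{wCop}(\Gamma)\in\mathbb{Z}_{>0}\cup\{\infty\}$ is the smallest positive integer $n$ such that $\Gamma$ is $n$-weak cop win, and $\infty$ if there is none. *)

(* Defs.v *)
From HB Require Import structures.
From mathcomp Require Import all_boot all_order all_algebra.
From mathcomp Require Import all_classical all_reals.
From mathcomp Require Import exp trigo.

Set Implicit Arguments.
Unset Strict Implicit.
Unset Printing Implicit Defensive.

Import Order.TTheory GRing.Theory Num.Theory.

Local Open Scope classical_set_scope.
Local Open Scope card_scope.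

Record graph := Graph {
  vert :> Type;
  adj : vert -> vert -> Prop;
  adj_sym : forall x y, adj x y -> adj y x;
  adj_irrefl : forall x, ~ adj x x }.

(** A walk of length [k] is the initial segment [w 0, ..., w k] of [w]. *)
Definition walk (G : graph) (w : nat -> G) (k : nat) (x y : G) : Prop :=
  [/\ w 0 = x, w k = y & forall i, i < k -> adj (w i) (w i.+1)].

(** "dist x y <= k" for the path distance, which is infinite between distinct
    connected components. *)
Definition dist_le (G : graph) (x y : G) (k : nat) : Prop :=
  exists2 j, j <= k & exists w, walk w j x y.

Section Game.
Variables (G : graph) (n sigma rho psi : nat).

(** The cops' strategy maps the robber's past positions [:: r_0; ...; r_(k-1)]
    to the cops' positions c_k; in particular the empty history gives c_0. The
    cops' own past positions are determined by the strategy, so they are not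
    passed as an argument. *)
Definition strategy := seq G -> 'I_n -> G.

Definition legal_strategy (S : strategy) : Prop :=
  forall (h : seq G) (r : G) (i : 'I_n), dist_le (S h i) (S (rcons h r) i) sigma.

Definition cop_pos (S : strategy) (r : nat -> G) (k : nat) : 'I_n -> G :=
  S (mkseq r k).

(** [c] is the position of the cops after their move, [x] that of the robber
    before his move. *)
Definition captured (c : 'I_n -> G) (x : G) : Prop :=
  exists i, dist_le x (c i) rho.

Definition robber_move (c : 'I_n -> G) (x y : G) : Prop :=
  exists2 k, k <= psi & exists2 w, walk w k x y &
    forall j, j <= k -> forall i, ~ dist_le (w j) (c i) rho.

(** A play is an infinite sequence [r] of robber positions, whose values after
    a capture are irrelevant. *)
Definition winning (v : G) (rad : nat) (S : strategy) : Prop :=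
  forall r : nat -> G,
    (forall k, ~ captured (cop_pos S r k.+1) (r k) ->
       robber_move (cop_pos S r k.+1) (r k) (r k.+1)) ->
    (exists k, captured (cop_pos S r k.+1) (r k)) \/
    (exists2 N, 0 < N & forall k, N <= k -> ~ dist_le v (r k) rad).

Definition CopWin (rad : nat) : Prop :=
  forall v : G, exists2 S, legal_strategy S & winning v rad S.

End Game.

Definition weak_cop_win (G : graph) (n : nat) : Prop :=
  exists2 sigma, 0 < sigma & exists rho, forall psi rad,
    0 < psi -> 0 < rad -> CopWin G n sigma rho psi rad.

Variant extnat := Fin of nat | Infty.

Definition wCop (G : graph) : extnat :=
  match pselect (exists n, `[< 0 < n /\ weak_cop_win G n >]) with
  | left ex => Fin (ex_minn ex)
  | right _ => Infty
  end.

Local Open Scope ring_scope.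

Definition lorentz {R : realType} (x y : 'rV[R]_3) : R :=
  - (x 0 0 * y 0 0) + x 0 1 * y 0 1 + x 0 2 * y 0 2.

(** The hyperboloid model of the hyperbolic plane. *)
Record hplane (R : realType) := HPlane {
  hvec :> 'rV[R]_3;
  hvecP : (lorentz hvec hvec == -1) && (0 < hvec 0 0) }.

HB.instance Definition _ (R : realType) := [isSub for @hvec R].

Section Hyperbolic.
Variable R : realType.
Implicit Types x y z : hplane R.

Definition arcosh (t : R) : R := ln (t + Num.sqrt (t ^+ 2 - 1)).

Definition hdist x y : R := arcosh (- lorentz x y).

(** Component of [x] tangent to the hyperboloid at [y]: it points in the
    direction of the geodesic from [y] to [x]. *)
Definition tangent y x : 'rV[R]_3 := (x : 'rV[R]_3) + lorentz x y *: (y : 'rV[R]_3).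

(** The angle at [y] of the geodesic triangle [x], [y], [z]. *)
Definition hangle x y z : R :=
  let s := tangent y x in let t := tangent y z in
  acos (lorentz s t / (Num.sqrt (lorentz s s) * Num.sqrt (lorentz t t))).

(** Geodesic lines are the sections of the hyperboloid by linear planes;
    [orient x y z > 0] says that [z] lies strictly on the left of the line
    directed from [x] to [y]. *)
Definition orient x y z : R :=
  \det (\matrix_(i < 3) ([:: (x : 'rV[R]_3); (y : 'rV[R]_3); (z : 'rV[R]_3)]`_i)).

(** The geodesic convex hull is cut out by the linear convex cone. *)
Definition hull (n : nat) (v : 'I_n -> hplane R) : set (hplane R) :=
  [set x | exists2 a : 'I_n -> R, forall i, 0 <= a i &
     (x : 'rV[R]_3) = \sum_(i < n) a i *: (v i : 'rV[R]_3)].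

Definition segment x y : set (hplane R) :=
  [set z | exists a b : R,
     [/\ 0 <= a, 0 <= b &
         (z : 'rV[R]_3) = a *: (x : 'rV[R]_3) + b *: (y : 'rV[R]_3)]].

Definition isometry (g : hplane R -> hplane R) : Prop :=
  bijective g /\ forall x y, hdist (g x) (g y) = hdist x y.

Definition congruent (A B : set (hplane R)) : Prop :=
  exists2 g, isometry g & g @` A = B.

(** A [p]-gon is given by its vertices listed cyclically ([ordS] is the
    successor modulo [p]), counterclockwise; the polygonal region is the [hull]
    of the vertices, and its sides are the segments from [P i] to
    [P (ordS i)]. *)
Definition convex_polygon (p : nat) (P : 'I_p -> hplane R) : Prop :=
  forall i j, j != i -> j != ordS i -> 0 < orient (P i) (P (ordS i)) (P j).

Definition regular_polygon (p : nat) (P : 'I_p -> hplane R) : Prop :=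
  [/\ convex_polygon P,
      forall i j, hdist (P i) (P (ordS i)) = hdist (P j) (P (ordS j)) &
      forall i j, hangle (P (ord_pred i)) (P i) (P (ordS i)) =
                  hangle (P (ord_pred j)) (P j) (P (ordS j))].

Section Tiling.
Variables (p q : nat) (T : set ('I_p -> hplane R)).

Definition tiling_vertex x : Prop := exists2 P, T P & exists i, P i = x.

Definition tiling_edge x y : Prop :=
  exists2 P, T P & exists i,
    (P i = x /\ P (ordS i) = y) \/ (P i = y /\ P (ordS i) = x).

(** Two distinct members of [T] are disjoint, or meet in a common vertex or in
    a common side. This forces their interiors to be disjoint, and prevents
    [T] from listing one region twice. *)
Definition edge_to_edge : Prop :=
  forall P Q, T P -> T Q -> P <> Q ->
    [\/ hull P `&` hull Q = set0,
        exists i j, P i = Q j /\ hull P `&` hull Q = [set P i] |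
        exists i j,
          hull P `&` hull Q = segment (P i) (P (ordS i)) /\
          segment (P i) (P (ordS i)) = segment (Q j) (Q (ordS j))].

Definition regular_tiling : Prop :=
  [/\ forall P, T P -> regular_polygon P,
      forall P Q, T P -> T Q -> congruent (hull P) (hull Q),
      forall x, exists2 P, T P & hull P x,
      edge_to_edge &
      forall x, tiling_vertex x -> [set P | T P /\ exists i, P i = x] #= `I_q].

End Tiling.

(** [G] is, up to isomorphism, the graph of vertices and edges of a tiling of
    the hyperbolic plane by regular [p]-gons, [q] at each vertex. *)
Definition hyperbolic_tiling_graph (G : graph) : Prop :=
  exists (p q : nat) (T : set ('I_p -> hplane R)),
    [/\ (3 <= p)%N, (3 <= q)%N, p%:R^-1 + q%:R^-1 < 2^-1 :> rat,
        regular_tiling q T &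
        exists f : G -> hplane R,
          [/\ injective f, range f = [set x | tiling_vertex T x] &
              forall a b : G, adj a b <-> tiling_edge T (f a) (f b)]].

End Hyperbolic.

(* Main.v *)
Require Import Defs.
From mathcomp Require Import all_boot all_order all_algebra.
From mathcomp Require Import all_classical all_reals.
From mathcomp Require Import topology normedtype sequences derive exp ring lra.

(** Why no number of cops suffices. Fix [n], [sigma], [rho] and put
    [L = rho + sigma]. Suppose that the graph contains a grid: [n.+1] connected
    rows and [n.+1] connected columns, every row meeting every column, any two
    rows more than [2 * L] apart, and any two columns as well. A cop is within
    [L] of at most one row and at most one column, so at any time some row and
    some column stay out of the cops' reach during their next move. The
    robber waits at the crossing of such a row and column and, after each move
    of the cops, runs along the row that is still safe to the next safe column,
    and along that column to the next safe row. The grid is finite, so a large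
    [psi] lets him do so, and he stays forever in one ball
    ([grid_not_CopWin]).

    The hyperbolic plane contains such grids at every scale: in the upper
    half-plane take horizontal segments at heights in a large geometric
    progression, and then vertical segments spaced so widely that they remain
    far apart at the greatest height in use. To move them to the tiling graph,
    replace a curve by the set of vertices of the tiles that it meets, its
    [tube]. Tiles have a common diameter bound, so curves that are far apart
    have tubes that are far apart ([tubes_far]); tubes of crossing curves have
    a vertex in common. Tubes are connected ([tube_joined]): the interval that
    parametrizes the curve is connected, hulls are closed, tiles with a common
    point share a vertex, and only finitely many tiles meet the curve. The last
    fact is a packing argument ([tiles_locally_finite]): all tiles contain a
    ball of one fixed radius, and distinct tiles overlap at most along a
    line. *)

Set Implicit Arguments.
Unset Strict Implicit.
Unset Printing Implicit Defensive.

(** * Walks *)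

Section Walks.
Variable G : graph.
Implicit Types (x y z : G) (V : set G) (k : nat).

Definition walk_in V k x y : Prop :=
  exists2 w : nat -> G, walk w k x y & forall j, j <= k -> V (w j).

Definition joined V x y : Prop := exists k, walk_in V k x y.

Lemma walk_in_refl V x : V x -> walk_in V 0 x x.
Proof. by move=> Vx; exists (fun=> x) => //; split. Qed.

Lemma walk_in_edge V x y : V x -> V y -> adj x y -> walk_in V 1 x y.
Proof.
move=> Vx Vy xy; exists (fun k => if k is 0 then x else y).
  by split=> // -[].
by case.
Qed.

Lemma walk_in_cat V k l x y z :
  walk_in V k x y -> walk_in V l y z -> walk_in V (k + l) x z.
Proof.
move=> [w [w0 wk wP] wV] [w' [w'0 w'l w'P] w'V].
exists (fun j => if j < k then w j else w' (j - k)); last first.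
  move=> j jkl; case: ltnP => jk; first by apply: wV; exact: ltnW.
  by apply: w'V; rewrite leq_subLR.
split.
- case: ltnP => [//|]; rewrite leqn0 => /eqP k0.
  by rewrite k0 subn0 w'0 -wk k0.
- by rewrite ltnNge leq_addr /= addKn.
- move=> j jkl; case: (ltnP j k) => jk; last first.
    rewrite ltnNge (leq_trans jk) //= subSn //.
    by apply: w'P; rewrite ltn_subLR.
  case: ltnP => jk1; first exact: wP.
  have jk' : j.+1 = k by apply/eqP; rewrite eqn_leq jk.
  by rewrite jk' subnn w'0 -wk -jk'; exact: wP.
Qed.

Lemma walk_in_rev V k x y : walk_in V k x y -> walk_in V k y x.
Proof.
move=> [w [w0 wk wP] wV]; exists (fun j => w (k - j)); last first.
  by move=> j _; apply: wV; rewrite leq_subr.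
split; rewrite ?subn0 ?subnn // => j jk.
apply: adj_sym; have -> : k - j = (k - j.+1).+1 by rewrite subnSK.
by apply: wP; rewrite ltn_subrL (leq_ltn_trans _ jk).
Qed.

Lemma walk_in_sub V V' k x y :
  (forall g, V g -> V' g) -> walk_in V k x y -> walk_in V' k x y.
Proof. by move=> VV' [w ww wV]; exists w => // j /wV/VV'. Qed.

Lemma joined_refl V x : V x -> joined V x x.
Proof. by move=> Vx; exists 0; exact: walk_in_refl. Qed.

Lemma joined_trans V x y z : joined V x y -> joined V y z -> joined V x z.
Proof. by move=> [k xy] [l yz]; exists (k + l); apply: walk_in_cat yz. Qed.

Lemma joined_sym V x y : joined V x y -> joined V y x.
Proof. by move=> [k xy]; exists k; exact: walk_in_rev. Qed.

(** The distance bound as a walk without constraint, so that the walk calculus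
    above yields symmetry and the triangle inequality. *)
Lemma dist_leP x y k :
  dist_le x y k <-> exists2 j, j <= k & walk_in setT j x y.
Proof.
by split=> -[j jk [w ww]]; exists j => //; exists w.
Qed.

Lemma dist_le_sym x y k : dist_le x y k -> dist_le y x k.
Proof.
by move=> /dist_leP[j jk xy]; apply/dist_leP; exists j => //;
  exact: walk_in_rev.
Qed.

Lemma dist_le_trans x y z k l :
  dist_le x y k -> dist_le y z l -> dist_le x z (k + l).
Proof.
move=> /dist_leP[j jk xy] /dist_leP[j' jl yz]; apply/dist_leP.
by exists (j + j'); [exact: leq_add|exact: walk_in_cat yz].
Qed.

Lemma dist_leW x y k l : k <= l -> dist_le x y k -> dist_le x y l.
Proof. by move=> kl [j jk xy]; exists j => //; exact: leq_trans kl. Qed.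

End Walks.

(** * Evasion on a grid *)

Definition far_apart (G : graph) m (C : 'I_m -> set G) (L : nat) : Prop :=
  forall i i' x x', C i x -> C i' x' -> dist_le x x' (L + L) -> i = i'.

Section Evasion.
Variables (G : graph) (n L : nat).

Definition unthreatened (c : 'I_n -> G) (A : set G) : Prop :=
  forall x, A x -> forall l, ~ dist_le x (c l) L.

(** A cop within [L] of two of the sets would bring them within [2 * L] of each
    other: each of the [n] cops threatens at most one of the [n.+1] sets. *)
Lemma pigeonhole_unthreatened (C : 'I_n.+1 -> set G) (c : 'I_n -> G) :
  far_apart C L -> exists i, unthreatened c (C i).
Proof.
move=> sepC; apply: contrapT => noi.
have /choice[h hP] : forall i, exists l, exists2 x, C i x & dist_le x (c l) L.
  move=> i; apply: contrapT => nol; apply: noi; exists i => x Cx l xl.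
  by apply: nol; exists l, x.
have /leq_card : injective h; last by rewrite !card_ord ltnn.
move=> i i' hii'; have [x Cx xl] := hP i; have [x' Cx' xl'] := hP i'.
apply: (sepC _ _ _ _ Cx Cx'); rewrite hii' in xl.
by apply: dist_le_trans xl _; exact: dist_le_sym.
Qed.

End Evasion.

(** The rows are the [C i], the columns the [D j]; [b i j] is a crossing. *)
Section Grid.
Variables (G : graph) (n sigma rho : nat).
Let m := n.+1.
Variables (b : 'I_m -> 'I_m -> G) (C D : 'I_m -> set G).
Hypotheses (Cjoined : forall i j j', joined (C i) (b i j) (b i j'))
  (Djoined : forall i i' j, joined (D j) (b i j) (b i' j)).
Hypotheses (sepC : far_apart C (rho + sigma))
  (sepD : far_apart D (rho + sigma)).

(** The robber always stands at the crossing of a row and a column that no cop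
    is within [rho + sigma] of. The next move of the cops leaves that row
    beyond [rho], and a new unthreatened pair exists; the robber runs along the
    old row to the new column, then along the new column to the new row. *)
Lemma grid_not_CopWin : exists psi rad,
  [/\ 0 < psi, 0 < rad & ~ CopWin G n sigma rho psi rad].
Proof.
have /choice[kC kCP] : forall t : 'I_m * 'I_m * 'I_m,
    exists k, walk_in (C t.1.1) k (b t.1.1 t.1.2) (b t.1.1 t.2).
  by move=> [[i j] j']; exact: Cjoined.
have /choice[kD kDP] : forall t : 'I_m * 'I_m * 'I_m,
    exists k, walk_in (D t.2) k (b t.1.1 t.2) (b t.1.2 t.2).
  by move=> [[i i'] j]; exact: Djoined.
(* Only finitely many walks are ever used, so one length bounds them all; it
   also bounds the distance from [b ord0 ord0] to every crossing. *)
pose psi := ((\max_t kC t) + (\max_t kD t)).+1.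
have lepsi i i' j j' : kC (i, j, j') + kD (i, i', j') <= psi.
  by rewrite leqW //; apply: leq_add; exact: leq_bigmax.
exists psi, psi; split=> // cw.
have {cw}[S legal win] := cw (b ord0 ord0).
have /choice[pick pickP] : forall c : 'I_n -> G, exists t : 'I_m * 'I_m,
    unthreatened (rho + sigma) c (C t.1) /\
    unthreatened (rho + sigma) c (D t.2).
  move=> c; have [i Hi] := pigeonhole_unthreatened c sepC.
  by have [j Hj] := pigeonhole_unthreatened c sepD; exists (i, j).
pose place t := b t.1 t.2.
(* [r k] depends on the answer of the strategy to the positions before it, so
   the history is what gets built by recursion. *)
pose hist := fix hist k := if k is k'.+1
  then rcons (hist k') (place (pick (S (hist k')))) else [::].
pose r k := place (pick (S (hist k))).
have histE k : mkseq r k = hist k.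
  by elim: k => // k IH; rewrite mkseqS IH.
have rE k : r k = place (pick (S (mkseq r k))) by rewrite histE.
have cop_step k l : dist_le (cop_pos S r k l) (cop_pos S r k.+1 l) sigma.
  by rewrite /cop_pos !histE; exact: legal.
have far_next k (A : set G) : unthreatened (rho + sigma) (cop_pos S r k) A ->
    unthreatened rho (cop_pos S r k.+1) A.
  move=> far x Ax l xl; apply: (far x Ax l).
  by apply: dist_le_trans xl _; apply: dist_le_sym.
have Cb i j : C i (b i j).
  by have [k [w [<- _ _] wC]] := Cjoined i j j; apply: wC.
have notcap k : ~ captured rho (cop_pos S r k.+1) (r k).
  move=> [l]; apply: (far_next k _ (pickP _).1).
  by rewrite rE; exact: Cb.
case: (win r).
- move=> k _; rewrite (rE k) (rE k.+1).
  have [farC _] := pickP (cop_pos S r k).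
  have [_ farD] := pickP (cop_pos S r k.+1).
  move: farC farD; rewrite /cop_pos /place.
  case: (pick (S (mkseq r k))) => i j; case: (pick _) => i' j' /= farC farD.
  have [w ww wV] : walk_in (C i `|` D j')%classic
      (kC (i, j, j') + kD (i, i', j')) (b i j) (b i' j').
    apply: walk_in_cat.
      by apply: walk_in_sub (kCP (i, j, j')); left.
    by apply: walk_in_sub (kDP (i, i', j')); right.
  exists (kC (i, j, j') + kD (i, i', j')) => //; exists w => // t /wV[Ct|Dt] l.
    exact: (far_next k _ farC).
  move=> tl; apply: (farD _ Dt l).
  exact: dist_leW (leq_addr _ _) tl.
- by move=> [k]; exact: notcap.
- move=> [N _ /(_ N (leqnn N))]; apply.
  rewrite rE /place; case: (pick _) => i j /=.
  apply/dist_leP; exists (kC (ord0, ord0, j) + kD (ord0, i, j)) => //.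
  apply: walk_in_cat.
    by apply: walk_in_sub (kCP (ord0, ord0, j)).
  by apply: walk_in_sub (kDP (ord0, i, j)).
Qed.

End Grid.

Lemma wCop_Infty (G : graph) :
  (forall n, ~ weak_cop_win G n) -> wCop G = Infty.
Proof.
move=> nowin; rewrite /wCop; case: pselect => // -[n ex]; exfalso.
by move: ex => /asboolP[_ /nowin].
Qed.

Import Order.TTheory GRing.Theory Num.Theory.
Import numFieldNormedType.Exports.
Local Open Scope classical_set_scope.
Local Open Scope ring_scope.

(** * The hyperboloid *)

Section Hyperboloid.
Variable R : realType.
Implicit Types (x y z : hplane R) (s t w : 'rV[R]_3).

(** The hyperbolic cosine of the distance. It is polynomial in the coordinates,
    hence takes the place of [hdist] in all estimates below. *)
Definition coshd x y : R := - lorentz x y.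

Lemma row3P s t : s 0 0 = t 0 0 -> s 0 1 = t 0 1 -> s 0 2 = t 0 2 -> s = t.
Proof.
move=> e0 e1 e2; apply/rowP => -[[|[|[|//]]] lt_i3].
- by rewrite (_ : Ordinal _ = 0) //; apply: val_inj.
- by rewrite (_ : Ordinal _ = 1) //; apply: val_inj.
- by rewrite (_ : Ordinal _ = 2) //; apply: val_inj.
Qed.

Lemma hplane_norm x : x 0 0 ^+ 2 = 1 + x 0 1 ^+ 2 + x 0 2 ^+ 2.
Proof. by have /andP[/eqP] := hvecP x; rewrite /lorentz => xx _; lra. Qed.

Lemma hplane_gt0 x : 0 < x 0 0.
Proof. by have /andP[] := hvecP x. Qed.

Lemma coshdE x y :
  coshd x y = x 0 0 * y 0 0 - x 0 1 * y 0 1 - x 0 2 * y 0 2.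
Proof. by rewrite /coshd /lorentz; ring. Qed.

Lemma coshdC x y : coshd x y = coshd y x.
Proof. by rewrite !coshdE; ring. Qed.

Lemma coshdxx x : coshd x x = 1.
Proof. by have := hplane_norm x; rewrite coshdE !expr2; lra. Qed.


Lemma ler_of_sqr (a b : R) : 0 <= b -> a ^+ 2 <= b ^+ 2 -> a <= b.
Proof.
by move=> b0; rewrite !expr2 => ab; rewrite leNgt; apply/negP => ba; nra.
Qed.

Lemma coshd_ge1 x y : 1 <= coshd x y.
Proof.
rewrite coshdE; have xx := hplane_norm x; have yy := hplane_norm y.
suff: 1 + (x 0 1 * y 0 1 + x 0 2 * y 0 2) <= x 0 0 * y 0 0 by lra.
apply: ler_of_sqr; first by rewrite mulr_ge0 // ltW // hplane_gt0.
rewrite exprMn xx yy -subr_ge0.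
set x1 := x 0 1; set x2 := x 0 2; set y1 := y 0 1; set y2 := y 0 2.
rewrite (_ : _ - _ =
    (x1 - y1) ^+ 2 + (x2 - y2) ^+ 2 + (x1 * y2 - x2 * y1) ^+ 2).
  by rewrite !addr_ge0 // sqr_ge0.
by ring.
Qed.

Definition det3 (s t w : 'rV[R]_3) : R :=
  s 0 0 * (t 0 1 * w 0 2 - t 0 2 * w 0 1)
  - s 0 1 * (t 0 0 * w 0 2 - t 0 2 * w 0 0)
  + s 0 2 * (t 0 0 * w 0 1 - t 0 1 * w 0 0).


Lemma det_mx33 (M : 'M[R]_3) :
  \det M = M 0 0 * (M 1 1 * M 2 2 - M 1 2 * M 2 1)
         - M 0 1 * (M 1 0 * M 2 2 - M 1 2 * M 2 0)
         + M 0 2 * (M 1 0 * M 2 1 - M 1 1 * M 2 0).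
Proof.
(* with entries indexed by natural numbers, the nested [lift]s compute *)
pose F i j := M (inord i) (inord j).
have ME i j : M i j = F (val i) (val j) by rewrite /F !inord_val.
rewrite (expand_det_row _ 0) !big_ord_recl big_ord0 /cofactor.
rewrite !(expand_det_row _ 0) !big_ord_recl !big_ord0 /cofactor !det_mx11 !mxE.
by rewrite !ME /= /bump /=; ring.
Qed.

Lemma orientE x y z : orient x y z = det3 x y z.
Proof. by rewrite /orient det_mx33 !mxE. Qed.

Lemma gram_det3 s t w :
  det3 s t w ^+ 2 =
  - (lorentz s s * (lorentz t t * lorentz w w - lorentz t w ^+ 2)
     - lorentz s t * (lorentz s t * lorentz w w - lorentz t w * lorentz s w)
     + lorentz s w * (lorentz s t * lorentz t w - lorentz t t * lorentz s w)).
Proof. by rewrite /det3 /lorentz; ring. Qed.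

Lemma lorentz_self x : lorentz x x = -1.
Proof. by have /andP[/eqP] := hvecP x. Qed.

(** The Gram determinant of three vectors is minus the square of their
    determinant, because the form has signature (2,1). For distances [a], [b]
    and [c] of [x y], [y z] and [x z], this says
    cosh(a - b) <= cosh c <= cosh(a + b), in polynomial form. *)
Lemma coshd_gram x y z :
  (coshd x z - coshd x y * coshd y z) ^+ 2 <=
  (coshd x y ^+ 2 - 1) * (coshd y z ^+ 2 - 1).
Proof.
rewrite -subr_ge0.
have := sqr_ge0 (det3 x y z).
rewrite gram_det3 !lorentz_self /coshd.
by congr (0 <= _); ring.
Qed.

(** From cosh(a + b) <= 2 cosh a cosh b: good enough for coarse estimates. *)
Lemma coshd_triangle x y z : coshd x z <= 2 * coshd x y * coshd y z.
Proof.
have := coshd_gram x y z.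
have := coshd_ge1 x y; have := coshd_ge1 y z.
set u := coshd x y; set v := coshd y z; set w := coshd x z => v1 u1 uvw.
suff : w - u * v <= u * v by lra.
apply: ler_of_sqr; first by nra.
apply: (le_trans uvw); rewrite exprMn.
have := sqr_ge0 u; have := sqr_ge0 v; have : 1 <= u ^+ 2 by nra.
by nra.
Qed.

(** Unlike the previous bound, this one tends to 1 when both distances tend
    to 0, so it compares small balls. *)
Lemma coshd_triangle_near x y z :
  coshd x z <= (coshd x y + coshd y z) ^+ 2 / 2 - 1.
Proof.
have := coshd_gram x y z.
have := coshd_ge1 x y; have := coshd_ge1 y z.
set u := coshd x y; set v := coshd y z; set w := coshd x z => v1 u1 uvw.
suff : w - u * v <= (u ^+ 2 + v ^+ 2 - 2) / 2 by nra.
apply: ler_of_sqr; first by nra.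
apply: (le_trans uvw); rewrite -subr_ge0.
rewrite (_ : _ - _ = ((u ^+ 2 - v ^+ 2) / 2) ^+ 2); first exact: sqr_ge0.
by field.
Qed.

(** Makes isometries of [hdist] preserve [coshd]. *)
Lemma arcosh_inj (a b : R) : 1 <= a -> 1 <= b -> arcosh a = arcosh b -> a = b.
Proof.
wlog ab : a b / a <= b.
  by move=> H a1 b1 e; case: (leP a b) => [|/ltW] ab; [|symmetry]; apply: H.
move=> a1 b1 e; apply/eqP; rewrite eq_le ab /= leNgt; apply/negP => ltab.
suff : arcosh a < arcosh b by rewrite e ltxx.
have r0 (c : R) : 0 <= Num.sqrt (c ^+ 2 - 1) by exact: sqrtr_ge0.
rewrite /arcosh ltr_ln ?posrE.
- by apply: ltr_leD => //; apply: ler_wsqrtr; rewrite lerD2r; nra.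
- by have := r0 a; lra.
- by have := r0 b; lra.
Qed.

Lemma hdist_coshd x y x' y' :
  hdist x y = hdist x' y' -> coshd x y = coshd x' y'.
Proof. by move=> e; apply: arcosh_inj e; exact: coshd_ge1. Qed.

Lemma hplane_eq x y : (x : 'rV[R]_3) = y -> x = y.
Proof. exact: val_inj. Qed.

Definition dot3 (w s : 'rV[R]_3) : R :=
  w 0 0 * s 0 0 + w 0 1 * s 0 1 + w 0 2 * s 0 2.

(** Write [z] as [coshd x z] times [x] plus a vector [s] orthogonal to [x]. The
    Lorentz form is Euclidean on the orthogonal plane of [x], up to the factor
    [x 0 0 ^+ 2], so [s] is small when [coshd x z] is near 1. *)
Lemma dot3_pos_near (w : 'rV[R]_3) x :
  0 < dot3 w x ->
  exists2 e, 0 < e & forall z, coshd x z < 1 + e -> 0 < dot3 w z.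
Proof.
set l := dot3 w => lx.
pose W := w 0 0 ^+ 2 + w 0 1 ^+ 2 + w 0 2 ^+ 2.
have W0 : 0 <= W by rewrite !addr_ge0 // sqr_ge0.
pose X := x 0 0 ^+ 2.
have X0 : 0 <= X by exact: sqr_ge0.
have d0 : 0 < 6 * W * X + 1 by nra.
(* By Cauchy-Schwarz [l s ^+ 2 <= 6 * W * X * (coshd x z - 1)] for the
   vector [s] above; the added 1 keeps the denominator positive. *)
exists (Num.min 1 (l x ^+ 2 / (6 * W * X + 1))).
  by rewrite lt_min ltr01 divr_gt0 // exprn_gt0.
move=> z; set u := coshd x z.
rewrite -ltrBlDl lt_min ltr_pdivlMr // => /andP[u2 ul].
have u1 : 1 <= u by exact: coshd_ge1.
pose s : 'rV[R]_3 := (z : 'rV_3) - u *: (x : 'rV_3).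
have lz : l z = u * l x + l s by rewrite /l /dot3 /s !mxE; ring.
have xx := hplane_norm x; have zz := hplane_norm z.
have s0 i : s 0 i = z 0 i - u * x 0 i by rewrite /s !mxE.
have sx : x 0 0 * s 0 0 = x 0 1 * s 0 1 + x 0 2 * s 0 2.
  rewrite !s0; have := coshdE x z; rewrite -/u => uE.
  rewrite !mulrBr !(mulrCA _ u) -!expr2 xx; lra.
have ss : s 0 1 ^+ 2 + s 0 2 ^+ 2 - s 0 0 ^+ 2 = u ^+ 2 - 1.
  have := coshdE x z; rewrite -/u => uE.
  have -> : s 0 1 ^+ 2 + s 0 2 ^+ 2 - s 0 0 ^+ 2 =
    (z 0 1 ^+ 2 + z 0 2 ^+ 2 - z 0 0 ^+ 2) +
    2 * u * (x 0 0 * z 0 0 - x 0 1 * z 0 1 - x 0 2 * z 0 2) +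
    u ^+ 2 * (x 0 1 ^+ 2 + x 0 2 ^+ 2 - x 0 0 ^+ 2) by rewrite !s0; ring.
  by rewrite -uE xx zz; ring.
clearbody s.
set S := s 0 1 ^+ 2 + s 0 2 ^+ 2 in ss.
have S0 : 0 <= S by rewrite addr_ge0 // sqr_ge0.
have xs : X * s 0 0 ^+ 2 <= (X - 1) * S.
  rewrite /X -exprMn sx xx /S -subr_ge0.
  rewrite (_ : _ - _ = (x 0 1 * s 0 2 - x 0 2 * s 0 1) ^+ 2).
    exact: sqr_ge0.
  by ring.
have X1 : 1 <= X by rewrite /X xx -addrA lerDl addr_ge0 // sqr_ge0.
have SX : S <= X * (u ^+ 2 - 1) by rewrite -ss; nra.
have ls : l s ^+ 2 <= W * (2 * S).
  have : l s ^+ 2 <= W * (s 0 0 ^+ 2 + s 0 1 ^+ 2 + s 0 2 ^+ 2).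
    rewrite -subr_ge0 /l /dot3 /W.
    rewrite (_ : _ - _ = (w 0 0 * s 0 1 - w 0 1 * s 0 0) ^+ 2 +
       (w 0 0 * s 0 2 - w 0 2 * s 0 0) ^+ 2 +
       (w 0 1 * s 0 2 - w 0 2 * s 0 1) ^+ 2).
      by rewrite !addr_ge0 // sqr_ge0.
    by ring.
  move=> /le_trans; apply; apply: ler_wpM2l => //.
  have : s 0 0 ^+ 2 <= S by nra.
  by rewrite /S; lra.
rewrite lz; suff : - l s < l x by nra.
rewrite ltNge; apply/negP => lxs.
have : l x ^+ 2 <= l s ^+ 2 by nra.
move=> ll; have u3 : u ^+ 2 - 1 <= 3 * (u - 1) by nra.
have : l x ^+ 2 <= 6 * W * X * (u - 1).
  apply: (le_trans ll); apply: (le_trans ls).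
  have -> : 6 * W * X * (u - 1) = W * (2 * (X * (3 * (u - 1)))) by ring.
  apply: ler_wpM2l => //; apply: ler_wpM2l => //.
  by apply: (le_trans SX); apply: ler_wpM2l.
by nra.
Qed.

End Hyperboloid.

(** * Upper half-plane coordinates *)

Section HalfPlane.
Variable R : realType.
Implicit Types (x y z : hplane R) (s t w : 'rV[R]_3) (a b h k : R).

(** The point with abscissa [a] and height [expR h] of the upper half-plane,
    carried to the hyperboloid. Recording the logarithm of the height makes
    every pair of reals the coordinates of a point. *)
Definition uhp_vec a h : 'rV[R]_3 :=
  \row_i [:: ((1 + a ^+ 2) * expR (- h) + expR h) / 2; a * expR (- h);
             ((a ^+ 2 - 1) * expR (- h) + expR h) / 2]`_i.

Lemma uhp_subproof a h :
  (lorentz (uhp_vec a h) (uhp_vec a h) == -1) && (0 < uhp_vec a h 0 0).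
Proof.
have F0 := expR_gt0 (- h); have E0 := expR_gt0 h; have EF := expRN h.
rewrite /lorentz !mxE /=; apply/andP; split.
  rewrite EF; apply/eqP; field; exact: lt0r_neq0.
apply: divr_gt0 => //; apply: addr_gt0 => //; apply: mulr_gt0 => //.
by have := sqr_ge0 a; lra.
Qed.

Definition uhp a h : hplane R := HPlane (uhp_subproof a h).

Lemma uhpE a h :
  (uhp a h 0 0 = ((1 + a ^+ 2) * expR (- h) + expR h) / 2) *
  (uhp a h 0 1 = a * expR (- h)) *
  (uhp a h 0 2 = ((a ^+ 2 - 1) * expR (- h) + expR h) / 2).
Proof. by rewrite !mxE. Qed.

Lemma coshd_uhp a b h k :
  coshd (uhp a h) (uhp b k) =
  ((a - b) ^+ 2 * (expR (- h) * expR (- k)) + expR (h - k) + expR (k - h)) / 2.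
Proof.
by rewrite coshdE !uhpE !expRD; field.
Qed.

Lemma coshd_origin x : coshd (uhp 0 0) x = x 0 0.
Proof. by rewrite coshdE !uhpE oppr0 expR0; field. Qed.

Lemma uhp_surj x : exists a h, x = uhp a h.
Proof.
have xx := hplane_norm x; have x0 := hplane_gt0 x.
have x02 : 0 < x 0 0 - x 0 2.
  rewrite subr_gt0 ltNge; apply/negP => x20.
  have := sqr_ge0 (x 0 1); rewrite !expr2 in xx *; nra.
set d := x 0 0 - x 0 2 in x02.
exists (x 0 1 / d), (- ln d).
have eN : expR (- - ln d) = d by rewrite opprK lnK.
have eP : expR (- ln d) = d^-1 by rewrite expRN lnK.
have onH (t u : R) :
    t - u = (x 0 0 ^+ 2 - (1 + x 0 1 ^+ 2 + x 0 2 ^+ 2)) / (2 * d) -> t = u.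
  by rewrite xx subrr mul0r => /eqP; rewrite subr_eq0 => /eqP.
apply: hplane_eq; apply: row3P; rewrite !uhpE ?eN ?eP.
- by apply: onH; rewrite /d; field; exact: lt0r_neq0.
- by field; exact: lt0r_neq0.
- by apply: onH; rewrite /d; field; exact: lt0r_neq0.
Qed.

(** In half-plane coordinates a plane section is an equation
    [A * (a ^+ 2 + y ^+ 2) + B * a + C = 0]; three points of one horizontal line
    near [x] already force its coefficients to vanish. *)
Lemma ball_not_coplanar (w : 'rV[R]_3) x e : 0 < e ->
  (forall z, coshd x z < 1 + e -> dot3 w z = 0) -> w = 0.
Proof.
move=> e0; have [a [h ->]] := uhp_surj x => wz.
pose E := expR (- h); pose F := expR h.
have E0 : 0 < E by exact: expR_gt0.
have F0 : 0 < F by exact: expR_gt0.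
(* chosen so that moving horizontally by [d] changes [coshd] by [e / 2] *)
pose d := Num.sqrt e / E.
have d0 : 0 < d by rewrite divr_gt0 // sqrtr_gt0.
have near c : (a - c) ^+ 2 <= d ^+ 2 ->
    w 0 0 * (((1 + c ^+ 2) * E + F) / 2) + w 0 1 * (c * E) +
    w 0 2 * (((c ^+ 2 - 1) * E + F) / 2) = 0.
  move=> ac; rewrite -(wz (uhp c h)) /dot3 ?uhpE //.
  rewrite coshd_uhp subrr expR0 -/E -expr2.
  have : (a - c) ^+ 2 * E ^+ 2 <= e.
    rewrite -[leRHS](sqr_sqrtr (ltW e0)) (_ : Num.sqrt e = d * E).
      by rewrite exprMn ler_wpM2r // sqr_ge0.
    by rewrite /d mulfVK ?lt0r_neq0.
  lra.
have w0 : _ = 0 := near a ltac:(by rewrite subrr expr2 mul0r sqr_ge0).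
have wp : _ = 0 := near (a + d) ltac:(by rewrite opprD addNKr sqrrN).
have wn : _ = 0 := near (a - d) ltac:(by rewrite opprB addrCA subrr addr0).
have w02 : w 0 0 + w 0 2 = 0.
  have : (w 0 0 + w 0 2) * (d ^+ 2 * E) = 0 by lra.
  move/eqP; rewrite mulf_eq0 (gt_eqF (mulr_gt0 (exprn_gt0 _ d0) E0)).
  by rewrite orbF => /eqP.
have w2E : w 0 2 = - w 0 0 by lra.
rewrite w2E in w0 wp wn.
have w1 : w 0 1 = 0.
  have : w 0 1 * (d * E) = 0 by lra.
  by move/eqP; rewrite mulf_eq0 (gt_eqF (mulr_gt0 d0 E0)) orbF => /eqP.
have w00 : w 0 0 = 0.
  rewrite w1 in w0.
  have : w 0 0 * E = 0 by lra.
  by move/eqP; rewrite mulf_eq0 (gt_eqF E0) orbF => /eqP.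
by apply: row3P; rewrite ?mxE // w2E w00 oppr0.
Qed.

Definition cross (s t : 'rV[R]_3) : 'rV[R]_3 :=
  \row_i [:: s 0 1 * t 0 2 - s 0 2 * t 0 1; s 0 2 * t 0 0 - s 0 0 * t 0 2;
             s 0 0 * t 0 1 - s 0 1 * t 0 0]`_i.

Lemma dot3_cross s t w : dot3 (cross s t) w = det3 s t w.
Proof. by rewrite /dot3 !mxE /= /det3; ring. Qed.

Lemma det3_rot s t w : det3 s t w = det3 t w s.
Proof. by rewrite /det3; ring. Qed.

Lemma cramer s t w (v : 'rV[R]_3) :
  det3 s t w *: v = det3 t w v *: s + det3 w s v *: t + det3 s t v *: w.
Proof. by apply: row3P; rewrite !mxE /det3; ring. Qed.

Lemma det3D s t w w' : det3 s t (w + w') = det3 s t w + det3 s t w'.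
Proof. by rewrite /det3 !mxE; ring. Qed.

Lemma det3Z s t w c : det3 s t (c *: w) = c * det3 s t w.
Proof. by rewrite /det3 !mxE; ring. Qed.

Lemma det3xx s t : (det3 s t s = 0) * (det3 s t t = 0).
Proof. by split; rewrite /det3; ring. Qed.

End HalfPlane.

(** * Polygons *)

Definition first_index p (p3 : (3 <= p)%N) : 'I_p := Ordinal (ltnW (ltnW p3)).

Section Polygon.
Variable R : realType.
Implicit Types (x y z : hplane R).
Variables (p : nat) (P : 'I_p -> hplane R).

Lemma hull_vertex i : hull P (P i).
Proof.
exists (fun k => (k == i)%:R) => [k|]; first exact: ler0n.
rewrite (bigD1 i) //= eqxx scale1r big1 ?addr0 // => k /negPf ->.
by rewrite scale0r.
Qed.

Lemma hull_cone3 i j k (a b c : R) z : 0 <= a -> 0 <= b -> 0 <= c ->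
  (z : 'rV[R]_3) = a *: (P i : 'rV[R]_3) + b *: (P j : 'rV[R]_3) +
    c *: (P k : 'rV[R]_3) ->
  hull P z.
Proof.
move=> a0 b0 c0 zE.
have pick l (d : R) :
    \sum_m ((m == l)%:R * d) *: (P m : 'rV[R]_3) = d *: (P l : 'rV[R]_3).
  rewrite (bigD1 l) //= eqxx mul1r big1 ?addr0 // => m /negPf ->.
  by rewrite mul0r scale0r.
exists (fun m => (m == i)%:R * a + (m == j)%:R * b + (m == k)%:R * c).
  by move=> m; rewrite !addr_ge0 // mulr_ge0 // ler0n.
rewrite zE -!pick -!big_split /=; apply: eq_bigr => m _.
by rewrite !scalerDl.
Qed.

Lemma coshd_comb x (a : 'I_p -> R) :
  (x : 'rV[R]_3) = \sum_i a i *: (P i : 'rV[R]_3) ->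
  forall y, coshd x y = \sum_i a i * coshd (P i) y.
Proof.
move=> xE y; rewrite coshdE xE !summxE !mulr_suml -!sumrB.
by apply: eq_bigr => i _; rewrite !mxE coshdE; ring.
Qed.

(** Expanding [coshd x x = 1] in the left argument gives a sum of the [a i]
    with weights at least 1. *)
Lemma hull_coef_sum_le1 x (a : 'I_p -> R) : (forall i, 0 <= a i) ->
  (x : 'rV[R]_3) = \sum_i a i *: (P i : 'rV[R]_3) -> \sum_i a i <= 1.
Proof.
move=> a0 xE; rewrite -(coshdxx x) (coshd_comb xE).
by apply: ler_sum => i _; rewrite ler_peMr // coshd_ge1.
Qed.

Lemma hull_coef_le1 x (a : 'I_p -> R) : (forall i, 0 <= a i) ->
  (x : 'rV[R]_3) = \sum_i a i *: (P i : 'rV[R]_3) -> forall i, a i <= 1.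
Proof.
move=> a0 xE i; apply: le_trans (hull_coef_sum_le1 a0 xE).
by rewrite (bigD1 i) //= lerDl sumr_ge0.
Qed.

Lemma hull_bounded :
  exists D, forall x y, hull P x -> hull P y -> coshd x y <= D.
Proof.
have coshd_le x y : hull P x -> coshd x y <= \sum_i coshd (P i) y.
  move=> [a a0 xE]; rewrite (coshd_comb xE); apply: ler_sum => i _.
  rewrite ler_piMl ?(hull_coef_le1 a0 xE) //.
  exact: le_trans (coshd_ge1 _ _).
exists (\sum_i \sum_j coshd (P j) (P i)) => x y xP yP.
apply: (le_trans (coshd_le _ _ xP)); apply: ler_sum => i _.
by rewrite coshdC; exact: coshd_le.
Qed.

Hypotheses (p3 : (3 <= p)%N) (convP : convex_polygon P).

Lemma polygon_det3_gt0 i : exists j, 0 < det3 (P i) (P (ordS i)) (P j).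
Proof.
have [j] : exists j, j \notin [set i; ordS i]%SET.
  apply/existsP; rewrite -negb_forall; apply/negP => /forallP ij.
  have : (#|'I_p| <= #|[set i; ordS i]%SET|)%N.
    by apply/subset_leq_card/fintype.subsetP => j _.
  by rewrite card_ord cards2 leqNgt (leq_trans _ p3) //; case: (_ != _).
rewrite !inE negb_or => /andP[ji jSi]; exists j.
by rewrite -orientE; exact: convP.
Qed.

(** Three vertices are linearly independent, and the normalized sum of the
    three lies in the interior of the cone that they span: the Cramer
    coefficients are linear forms, positive there and hence nearby. *)
Lemma hull_inball : exists c e,
  [/\ 0 < e, hull P c & forall z, coshd c z < 1 + e -> hull P z].
Proof.
have i := first_index p3; have [j] := polygon_det3_gt0 i.
set A := P i; set B := P (ordS i); set C := P j; set d := det3 A B C => d0.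
pose s : 'rV[R]_3 := (A : 'rV_3) + (B : 'rV_3) + (C : 'rV_3).
pose N := - lorentz s s.
have NE : N = 3 + 2 * (coshd A B + coshd A C + coshd B C).
  have := lorentz_self A; have := lorentz_self B; have := lorentz_self C.
  by rewrite /N /s !coshdE /lorentz !mxE => *; lra.
have N0 : 0 < N.
  by have := coshd_ge1 A B; have := coshd_ge1 A C; have := coshd_ge1 B C; lra.
pose n := (Num.sqrt N)^-1.
have n0 : 0 < n by rewrite invr_gt0 sqrtr_gt0.
have nN : n ^+ 2 * N = 1 by rewrite exprVn sqr_sqrtr ?ltW // mulVf // lt0r_neq0.
have cP : (lorentz (n *: s) (n *: s) == -1) && (0 < (n *: s) 0 0).
  apply/andP; split.
    apply/eqP; rewrite -nN /N /lorentz !mxE; ring.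
  by rewrite !mxE mulr_gt0 // !addr_gt0 // hplane_gt0.
pose c := HPlane cP.
have cE (w t : 'rV[R]_3) :
    det3 w t c = n * (det3 w t A + det3 w t B + det3 w t C).
  by rewrite -!det3D -det3Z.
have BC : 0 < dot3 (cross B C) c.
  by rewrite dot3_cross cE !det3xx !addr0 -det3_rot mulr_gt0.
have CA : 0 < dot3 (cross C A) c.
  by rewrite dot3_cross cE !det3xx addr0 add0r det3_rot mulr_gt0.
have AB : 0 < dot3 (cross A B) c.
  by rewrite dot3_cross cE !det3xx !add0r mulr_gt0.
have [e1 e10 H1] := dot3_pos_near BC.
have [e2 e20 H2] := dot3_pos_near CA.
have [e3 e30 H3] := dot3_pos_near AB.
pose e := Num.min e1 (Num.min e2 e3).
have e0 : 0 < e by rewrite !lt_min e10 e20.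
have inball z : coshd c z < 1 + e -> hull P z.
  rewrite -ltrBlDl !lt_min !ltrBlDl => /and3P[/H1 z1 /H2 z2 /H3 z3].
  rewrite !dot3_cross in z1 z2 z3.
  apply: (@hull_cone3 i (ordS i) j
    (det3 B C z / d) (det3 C A z / d) (det3 A B z / d)).
  1-3: by rewrite divr_ge0 // ltW.
  apply: (scalerI (lt0r_neq0 d0)); rewrite cramer !scalerDr !scalerA.
  by rewrite !(mulrC d) !mulfVK ?lt0r_neq0.
by exists c, e; split=> //; apply: inball; rewrite coshdxx ltrDl.
Qed.

Lemma segment_vertexl i : segment (P i) (P (ordS i)) (P i).
Proof. by exists 1, 0; rewrite ler01 lexx scale1r scale0r addr0. Qed.

Lemma segment_vertexr i : segment (P i) (P (ordS i)) (P (ordS i)).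
Proof. by exists 0, 1; rewrite ler01 lexx scale1r scale0r add0r. Qed.

Lemma vertices_free i (a b : R) :
  a *: (P i : 'rV[R]_3) + b *: (P (ordS i) : 'rV[R]_3) = 0 -> a = 0 /\ b = 0.
Proof.
have [j d0] := polygon_det3_gt0 i.
set s := _ + _ => s0; have det_s t w : det3 t w s = 0.
  by rewrite s0 -(scale0r 0) det3Z mul0r.
have := det_s (P (ordS i)) (P j).
rewrite det3D !det3Z det3xx mulr0 addr0 -det3_rot => /eqP.
rewrite mulf_eq0 (gt_eqF d0) orbF => /eqP a0.
have := det_s (P j) (P i).
rewrite det3D !det3Z det3xx mulr0 add0r det3_rot => /eqP.
by rewrite mulf_eq0 (gt_eqF d0) orbF => /eqP.
Qed.

End Polygon.

Lemma hplane_collinear (R : realType) (x y : hplane R) a :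
  0 <= a -> (x : 'rV[R]_3) = a *: (y : 'rV[R]_3) -> x = y.
Proof.
move=> a0 xy; have : lorentz x x = a ^+ 2 * lorentz y y.
  by rewrite xy /lorentz !mxE; ring.
rewrite !lorentz_self => a2.
have a1 : a = 1 by apply/eqP; rewrite -(sqrp_eq1 a0); apply/eqP; lra.
by apply: hplane_eq; rewrite xy a1 scale1r.
Qed.

(** * Tiles *)

Section Tiling.
Variable R : realType.
Implicit Types (x y z : hplane R).
Variables (p q : nat) (T : set ('I_p -> hplane R)).
Hypotheses (p3 : (3 <= p)%N) (tilingT : regular_tiling q T).
Implicit Types P Q : 'I_p -> hplane R.

Let convT P : T P -> convex_polygon P.
Proof. by case: tilingT => H _ _ _ _ /H[]. Qed.

Lemma tile_cover x : exists2 P, T P & hull P x.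
Proof. by case: tilingT. Qed.

Lemma tile_isometry P Q : T P -> T Q -> exists2 g : hplane R -> hplane R,
  (forall z, hull Q z -> exists2 y, hull P y & z = g y) /\
  (forall y, hull P y -> hull Q (g y)) &
  (forall z, exists y, z = g y) /\ (forall x y, coshd (g x) (g y) = coshd x y).
Proof.
case: tilingT => _ H _ _ _ TP TQ; have [g [gbij gd] gPQ] := H _ _ TP TQ.
exists g; split.
- by move=> z; rewrite -gPQ => -[y yP <-]; exists y.
- by move=> y yP; rewrite -gPQ; exists y.
- by case: gbij => g' _ g'K z; exists (g' z); rewrite g'K.
- by move=> x y; apply: hdist_coshd.
Qed.

(** Congruence transports the diameter bound of one tile to all of them. *)
Lemma tile_bounded :
  exists D, forall P x y, T P -> hull P x -> hull P y -> coshd x y <= D.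
Proof.
have [P0 TP0 _] := tile_cover (uhp 0 0).
have [D HD] := hull_bounded P0; exists D => Q x y TQ xQ yQ.
have [g [gP _] [_ gd]] := tile_isometry TP0 TQ.
have [x' x'P ->] := gP _ xQ; have [y' y'P ->] := gP _ yQ.
by rewrite gd; exact: HD.
Qed.

(** Congruence transports an inscribed ball as well; the radius is uniform. *)
Lemma tile_inball : exists2 e, 0 < e & forall P, T P ->
  exists2 c, hull P c & forall z, coshd c z < 1 + e -> hull P z.
Proof.
have [P0 TP0 _] := tile_cover (uhp 0 0).
have [c [e [e0 cP eP]]] := hull_inball p3 (convT TP0).
exists e => // Q TQ; have [g [_ gP] [gsurj gd]] := tile_isometry TP0 TQ.
exists (g c) => [|z]; first exact: gP.
by have [y ->] := gsurj z; rewrite gd => /eP; exact: gP.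
Qed.

Lemma tile_inter_coplanar P Q : T P -> T Q -> P <> Q -> exists i,
  forall z, hull P z -> hull Q z -> det3 (P i) (P (ordS i)) z = 0.
Proof.
case: tilingT => _ _ _ H _ TP TQ PQ; case: (H _ _ TP TQ PQ).
- move=> PQ0; exists (first_index p3) => z zP zQ.
  by have : set0 z by rewrite -PQ0.
- move=> [i [j [_ PQi]]]; exists i => z zP zQ.
  have : [set P i] z by rewrite -PQi.
  by move=> ->; rewrite det3xx.
- move=> [i [j [PQi _]]]; exists i => z zP zQ.
  have [a [b [_ _ ->]]] : segment (P i) (P (ordS i)) z by rewrite -PQi.
  by rewrite det3D !det3Z !det3xx !mulr0 addr0.
Qed.

(** When the tiles meet in a common side, the two descriptions of the side have
    the same endpoints: [P i] is a nonnegative combination of the endpoints of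
    the other segment, themselves nonnegative combinations of [P i] and
    [P (ordS i)], so one of them is proportional to [P i]. *)
Lemma tile_share_vertex P Q z : T P -> T Q -> hull P z -> hull Q z ->
  exists i j, P i = Q j.
Proof.
case: tilingT => _ _ _ H _ TP TQ zP zQ.
have [<-|PQ] := pselect (P = Q); 
  first by exists (first_index p3), (first_index p3).
case: (H _ _ TP TQ PQ) => {PQ}.
- by move=> PQ0; have : set0 z by rewrite -PQ0.
- by move=> [i [j [PQi _]]]; exists i, j.
move=> [i [j [_ sPQ]]].
have [a [b [a0 b0 PE]]] : segment (Q j) (Q (ordS j)) (P i).
  by rewrite -sPQ; exact: segment_vertexl.
have [c [d [c0 d0 QE]]] : segment (P i) (P (ordS i)) (Q j).
  by rewrite sPQ; exact: segment_vertexl.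
have [e [f [e0 f0 SE]]] : segment (P i) (P (ordS i)) (Q (ordS j)).
  by rewrite sPQ; exact: segment_vertexr.
have PP : (a * c + b * e - 1) *: (P i : 'rV_3) +
    (a * d + b * f) *: (P (ordS i) : 'rV_3) = 0.
  have : a *: (Q j : 'rV_3) + b *: (Q (ordS j) : 'rV_3) - (P i : 'rV_3) = 0.
    by rewrite -PE subrr.
  move=> <-; rewrite QE SE; apply: row3P; rewrite !mxE; ring.
have [ace adf] := vertices_free p3 (convT TP) PP.
have ad0 : a * d = 0.
  by apply/eqP; rewrite eq_le mulr_ge0 // andbT -adf lerDl mulr_ge0.
have bf0 : b * f = 0 by lra.
have [a0'|a0'] := eqVneq a 0.
  have b0' : b != 0.
    apply/eqP => b0'; move/eqP: ace.
    by rewrite a0' b0' !mul0r add0r sub0r oppr_eq0 oner_eq0.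
  exists i, (ordS j); apply/esym/(hplane_collinear e0).
  move/eqP: bf0; rewrite mulf_eq0 (negPf b0') /= SE => /eqP ->.
  by rewrite scale0r addr0.
exists i, j; apply/esym/(hplane_collinear c0).
move/eqP: ad0; rewrite mulf_eq0 (negPf a0') /= QE => /eqP ->.
by rewrite scale0r addr0.
Qed.

(** If the inscribed balls of two tiles had close centers, a smaller ball would
    lie in both tiles, whose intersection is contained in a line. *)
Lemma tile_centers : exists2 e, 0 < e &
  exists c : ('I_p -> hplane R) -> hplane R,
  (forall P, T P -> hull P (c P)) /\
  (forall P Q, T P -> T Q -> coshd (c P) (c Q) < 1 + e -> P = Q).
Proof.
have [e e0 inb] := tile_inball.
have /choice[c cP] : forall P, exists c,
    T P -> hull P c /\ forall z, coshd c z < 1 + e -> hull P z.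
  move=> P; case: (pselect (T P)) => [/inb[c cP eP]|nT]; first by exists c.
  by exists (uhp 0 0).
pose e' := Num.min 1 (e / 8).
have e'0 : 0 < e' by rewrite lt_min ltr01 divr_gt0.
have e'1 : e' <= 1 by rewrite ge_min lexx.
have e'8 : e' <= e / 8 by rewrite ge_min lexx orbT.
exists e' => //; exists c; split=> [P /cP[]//|P Q TP TQ PQ].
apply: contrapT => neqPQ.
have {neqPQ}[i copl] := tile_inter_coplanar TP TQ neqPQ.
have [_ inP] := cP _ TP; have [_ inQ] := cP _ TQ.
have w0 : cross (P i) (P (ordS i)) = 0.
  apply: (ball_not_coplanar e'0) => z zP; rewrite dot3_cross.
  apply: copl; first by apply: inP; lra.
  apply: inQ; have := coshd_triangle_near (c Q) (c P) z.
  have := coshd_ge1 (c P) z; have := coshd_ge1 (c Q) (c P).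
  rewrite (coshdC (c Q) (c P)) => u1 v1.
  by nra.
have [j] := polygon_det3_gt0 p3 (convT TP) i.
by rewrite -dot3_cross w0 /dot3 !mxE !mul0r !addr0 ltxx.
Qed.

(** Packing: project the centers to the last two coordinates, where the
    Euclidean distance dominates [coshd] minus 1, and cut the bounded region
    that they occupy into square cells; two centers in one cell would be too
    close, so a tile is determined by its cell. *)
Lemma tiles_locally_finite (B : R) :
  finite_set [set P | T P /\ exists2 z, hull P z & coshd (uhp 0 0) z <= B].
Proof.
have [e e0 [c [cT cI]]] := tile_centers.
have [D HD] := tile_bounded.
set A := [set _ | _].
pose M := 2 * B * D.
have cM P : A P -> c P 0 0 <= M.
  move=> [TP [z zP zB]]; rewrite -coshd_origin.
  apply: le_trans (coshd_triangle _ z _) _.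
  have := HD _ _ _ TP zP (cT _ TP).
  have := coshd_ge1 (uhp 0 0) z; have := coshd_ge1 z (c P).
  rewrite /M; nra.
have cM' P : A P -> - M <= c P 0 1 <= M /\ - M <= c P 0 2 <= M.
  move=> AP.
  have := cM P AP; have := hplane_norm (c P); have := hplane_gt0 (c P).
  move=> c0 cc cm.
  have bound t : t ^+ 2 <= c P 0 0 ^+ 2 -> - M <= t <= M.
    move=> tc; apply/andP; split; first rewrite lerNl;
      by apply: le_trans cm; apply: ler_of_sqr; rewrite ?sqrrN // ltW.
  by split; apply: bound; rewrite cc;
    have := sqr_ge0 (c P 0 1); have := sqr_ge0 (c P 0 2); lra.
pose d := Num.min 1 e.
have d0 : 0 < d by rewrite lt_min ltr01.
have d1 : d <= 1 by rewrite ge_min lexx.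
have de : d <= e by rewrite ge_min lexx orbT.
pose cell (t : R) := Num.truncn ((t + M) / d).
have cell_itv t : - M <= t -> (cell t)%:R * d <= t + M < (cell t).+1%:R * d.
  move=> tM; rewrite -ler_pdivlMr // -ltr_pdivrMr //.
  by apply: truncn_itv; rewrite divr_ge0 // ?(ltW d0) //; lra.
have cell_near t t' : - M <= t -> - M <= t' -> cell t = cell t' ->
    (t - t') ^+ 2 < d ^+ 2.
  move=> /cell_itv/andP[] + + /cell_itv/andP[] + + tt'.
  rewrite tt' -natr1 mulrDl mul1r.
  by nra.
have cell_le t : t <= M -> (cell t <= Num.truncn ((M + M) / d))%N.
  move=> tM; apply: le_truncn; rewrite ler_pM2r ?invr_gt0 //; lra.
pose K := (Num.truncn ((M + M) / d)).+1.
pose F P := (cell (c P 0 1), cell (c P 0 2)).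
have Finj : {in A &, injective F}.
  move=> P Q /set_mem AP /set_mem AQ [e1 e2].
  have [/andP[P1 _] /andP[P2 _]] := cM' P AP.
  have [/andP[Q1 _] /andP[Q2 _]] := cM' Q AQ.
  apply: cI; [by case: AP|by case: AQ|].
  have := cell_near _ _ P1 Q1 e1; have := cell_near _ _ P2 Q2 e2.
  have := hplane_norm (c P); have := hplane_norm (c Q); rewrite coshdE.
  have := sqr_ge0 (c P 0 0 - c Q 0 0).
  by nra.
rewrite -(eq_finite_set (inj_card_eq Finj)).
apply: (@sub_finite_set _ _ (`I_K `*` `I_K)).
  move=> _ [P /cM'[/andP[_ P1] /andP[_ P2]] <-].
  by split; rewrite /= ltnS; exact: cell_le.
by apply: finite_setX; exact: finite_II.
Qed.

End Tiling.

(** * Curves through the tiling *)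

Section Continuity.
Variable R : realType.

Lemma rV3_continuous (f : R -> 'rV[R]_3) :
  continuous (fun t => f t 0 0) -> continuous (fun t => f t 0 1) ->
  continuous (fun t => f t 0 2) -> continuous f.
Proof.
move=> c0 c1 c2.
pose d (i : 'I_3) : 'rV[R]_3 := delta_mx 0 i.
have -> : f = (fun t => f t 0 0 *: d 0 + f t 0 1 *: d 1 + f t 0 2 *: d 2).
  by apply/funext => t; apply: row3P; rewrite !mxE /=; ring.
move=> t; apply: cvgD; first apply: cvgD.
- by apply: cvgZr_tmp; exact: c0.
- by apply: cvgZr_tmp; exact: c1.
- by apply: cvgZr_tmp; exact: c2.
Qed.

Lemma uhp_continuous (a h : R -> R) : continuous a -> continuous h ->
  continuous (fun t => uhp (a t) (h t) : 'rV[R]_3).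
Proof.
move=> ca ch.
have cF : continuous (fun t => expR (h t)).
  by move=> t; apply: continuous_comp; [exact: ch|exact: continuous_expR].
have cE : continuous (fun t => expR (- h t)).
  move=> t; apply: continuous_comp; last exact: continuous_expR.
  by apply: cvgN; exact: ch.
have ca2 : continuous (fun t => a t ^+ 2).
  by under eq_fun do rewrite expr2; move=> t; apply: cvgM; exact: ca.
apply: rV3_continuous.
- under eq_fun do rewrite uhpE.
  move=> t; apply: cvgM; last exact: cvg_cst.
  apply: cvgD; last exact: cF.
  apply: cvgM; last exact: cE.
  by apply: cvgD; [exact: cvg_cst|exact: ca2].
- under eq_fun do rewrite uhpE.
  by move=> t; apply: cvgM; [exact: ca|exact: cE].
- under eq_fun do rewrite uhpE.
  move=> t; apply: cvgM; last exact: cvg_cst.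
  apply: cvgD; last exact: cF.
  apply: cvgM; last exact: cE.
  by apply: cvgB; [exact: ca2|exact: cvg_cst].
Qed.

(** The coefficients of a point of the hull are at most 1, so the hull is the
    trace on the hyperboloid of a compact set, the image of a cube. *)
Lemma hull_closed p (P : 'I_p -> hplane R) (g : R -> hplane R) :
  continuous (fun t => g t : 'rV[R]_3) -> closed [set t | hull P (g t)].
Proof.
move=> cg.
pose comb (a : 'rV[R]_p) : 'rV[R]_3 := \sum_i a 0 i *: (P i : 'rV[R]_3).
pose cube := [set a : 'rV[R]_p | forall i, `[0, 1]%classic (a ord0 i)].
have cube_compact : compact cube.
  exact: (@rV_compact R p (fun=> `[0, 1]%classic)
    (fun=> @segment_compact R 0 1)).
have Kclosed : closed (comb @` cube).
  apply: compact_closed; first exact: norm_hausdorff.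
  apply: continuous_compact; last exact: cube_compact.
  apply: continuous_subspaceT => a; have Fa : Filter (nbhs a) := nbhs_filter a.
  apply: (@cvg_big _ _ _ _ _ _ _ _ _ _ _ Fa) => [|i _].
    exact: add_continuous.
  by apply: (@cvgZr_tmp _ _ _ _ Fa); exact: coord_continuous.
rewrite (_ : [set t | _] = (fun t => g t : 'rV[R]_3) @^-1` (comb @` cube)).
  by move/continuous_closedP: cg; exact.
apply/seteqP; split=> t /=.
  move=> [a a0 gE]; exists (\row_i a i) => [i|].
    by rewrite /= mxE in_itv /= a0 (hull_coef_le1 a0 gE).
  by rewrite gE; apply: eq_bigr => i _; rewrite mxE.
move=> [a a01 gE]; exists (fun i => a 0 i) => // i.
by have := a01 i; rewrite /= in_itv /= => /andP[].
Qed.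

End Continuity.

Section TilingGraph.
Variable R : realType.
Variables (p q : nat) (T : set ('I_p -> hplane R)).
Hypotheses (p3 : (3 <= p)%N) (tilingT : regular_tiling q T).
Variables (G : graph) (f : G -> hplane R).
Hypotheses (f_range : range f = [set x | tiling_vertex T x])
  (f_inj : injective f)
  (adjE : forall a b : G, adj a b <-> tiling_edge T (f a) (f b)).
Implicit Types (P Q : 'I_p -> hplane R) (x y : G) (A : set (hplane R)).

Lemma vertex_of_tile P i : T P -> exists x, f x = P i.
Proof.
move=> TP; have : range f (P i) by rewrite f_range; exists P => //; exists i.
by move=> [x _ <-]; exists x.
Qed.

(** The graph's stand-in for a subset [A] of the plane: the vertices of the
    tiles that meet [A]. *)
Definition tube A : set G :=
  [set x | exists P, [/\ T P, exists2 z, A z & hull P z & exists i, P i = f x]].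

Lemma tube_tile_joined A P z i j x y : T P -> A z -> hull P z ->
  P i = f x -> P j = f y -> joined (tube A) x y.
Proof.
move=> TP Az Pz Pix Pjy.
have inA k v : P k = f v -> tube A v.
  by move=> Pv; exists P; split=> //; [exists z|exists k].
have [o fo] := vertex_of_tile (first_index p3) TP.
suff from_o k v : P k = f v -> joined (tube A) o v.
  exact: joined_trans (joined_sym (from_o _ _ Pix)) (from_o _ _ Pjy).
case: k => k; elim: k v => [|k IH] v kp Pv.
  have -> : v = o by apply: f_inj; rewrite -Pv fo; congr P; exact: val_inj.
  by apply: joined_refl; exact: inA _ _ (esym fo).
have kp' : (k < p)%N by exact: ltnW.
have [u fu] := vertex_of_tile (Ordinal kp') TP.
apply: joined_trans (IH u kp' (esym fu)) _.
exists 1%N; apply: walk_in_edge; [exact: inA _ _ (esym fu)|exact: inA _ _ Pv|].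
apply/adjE; exists P => //; exists (Ordinal kp'); left; split=> //.
by rewrite -Pv; congr P; apply: val_inj; rewrite /= modn_small.
Qed.

(** The tube of a curve is connected. Call a tile meeting the curve good if its
    vertices are joined to [x], bad otherwise. Good tiles cover a closed part
    of the parameter interval, and so do bad ones, since finitely many tiles
    meet the curve. The two parts are disjoint, because tiles with a common
    point share a vertex; as the interval is connected, none is bad. *)
Lemma tube_joined (g : R -> hplane R) (a b : R) P Q s t i j x y :
  continuous (fun t => g t : 'rV[R]_3) ->
  T P -> T Q -> `[a, b]%classic s -> `[a, b]%classic t ->
  hull P (g s) -> hull Q (g t) ->
  P i = f x -> Q j = f y -> joined (tube (g @` `[a, b])) x y.
Proof.
move=> cg TP TQ abs abt Ps Qt Pix Qjy.
set A := g @` _.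
have inA r : `[a, b]%classic r -> A (g r) by move=> abr; exists r.
pose meet := [set P' | T P' /\ exists2 r, `[a, b]%classic r & hull P' (g r)].
have meet_fin : finite_set meet.
  have ab : a <= b by move: abs; rewrite /= in_itv => /andP[]; exact: le_trans.
  have cg0 : continuous (fun t => g t 0 0).
    move=> r; apply: (@continuous_comp _ _ _
      (fun t => g t : 'rV[R]_3) (fun v : 'rV[R]_3 => v 0 0)).
      exact: cg.
    exact: coord_continuous.
  have [c _ cmax] := EVT_max ab (continuous_subspaceT cg0).
  apply: sub_finite_set (tiles_locally_finite p3 tilingT (g c 0 0)).
  move=> P' [TP' [r abr rP']]; split=> //; exists (g r) => //.
  by rewrite coshd_origin; exact: cmax.
pose linked P' := exists k v, P' k = f v /\ joined (tube A) x v.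
pose reach (B : set ('I_p -> hplane R)) :=
  \bigcup_(P' in B) [set r | hull P' (g r)].
have reach_closed B : B `<=` meet -> closed (reach B).
  move=> Bmeet; apply: (@closed_bigcup _ {classic 'I_p -> hplane R}).
    exact: sub_finite_set meet_fin.
  by move=> P' _; exact: hull_closed.
have linked_all P' k v r : meet P' -> linked P' -> `[a, b]%classic r ->
    hull P' (g r) -> P' k = f v -> joined (tube A) x v.
  move=> [TP' _] [l [u [P'u xu]]] abr P'r P'v.
  exact: joined_trans xu (tube_tile_joined TP' (inA _ abr) P'r P'u P'v).
pose good := [set P' | meet P' /\ linked P'].
pose bad := [set P' | meet P' /\ ~ linked P'].
have good_bad r : `[a, b]%classic r -> reach good r -> reach bad r -> False.
  move=> abr [P1 [mP1 lP1] P1r] [P2 [mP2 nlP2] P2r]; apply: nlP2.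
  have [k [l P12]] := tile_share_vertex p3 tilingT mP1.1 mP2.1 P1r P2r.
  have [v fv] := vertex_of_tile k mP1.1.
  exists l, v; split; first by rewrite -P12 fv.
  exact: (linked_all _ _ _ _ mP1 lP1 abr P1r (esym fv)).
have covered r : `[a, b]%classic r -> reach good r \/ reach bad r.
  move=> abr; have [P' TP' P'r] := tile_cover tilingT (g r).
  have mP' : meet P' by split=> //; exists r.
  by have [lP'|nlP'] := pselect (linked P'); [left|right]; exists P'.
have goodE : `[a, b]%classic `&` reach good = `[a, b]%classic.
  apply: (@segment_connected _ a b).
  - exists s; split=> //; exists P => //; split; first by split=> //; exists s.
    exists i, x; split=> //; apply: joined_refl.
    by exists P; split=> //; [exists (g s) => //; exact: inA|exists i].
  - exists (~` reach bad); first by rewrite openC; apply: reach_closed => P' [].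
    apply/seteqP; split=> r [abr rr]; split=> //.
      by move=> /(good_bad _ abr rr).
    by have [//|/rr] := covered _ abr.
  - by exists (reach good) => //; apply: reach_closed => P' [].
have [_ gt] : (`[a, b]%classic `&` reach good) t by rewrite goodE.
have lQ : linked Q.
  apply: contrapT => nlQ; apply: (good_bad _ abt gt).
  by exists Q => //; split=> //; split=> //; exists t.
apply: (linked_all _ _ _ _ _ lQ abt Qt Qjy).
by split=> //; exists t.
Qed.

(** Along an edge [coshd] is at most the diameter bound [D] of a tile, and each
    use of the triangle inequality costs a factor 2. *)
Lemma coshd_distortion : exists2 D : R, 1 <= D &
  (forall x y k, dist_le x y k -> coshd (f x) (f y) <= (2 * D) ^+ k) /\
  (forall A x, tube A x -> exists2 z, A z & coshd z (f x) <= D).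
Proof.
have [D HD] := tile_bounded tilingT.
have D1 : 1 <= D.
  have [P TP oP] := tile_cover tilingT (uhp 0 0).
  by rewrite -(coshdxx (uhp 0 0)); exact: (HD P).
have D2 : 1 <= 2 * D by lra.
have adjD x y : adj x y -> coshd (f x) (f y) <= D.
  by move=> /adjE[P TP [i [[<- <-]|[<- <-]]]]; apply: (HD P) => //;
    exact: hull_vertex.
exists D => //; split=> [x y k [j jk [w [w0 wj wadj]]]|A x].
  apply: le_trans (ler_weXn2l D2 jk); rewrite -w0 -wj {w0 wj jk}.
  elim: j wadj => [|j IH] wadj; first by rewrite coshdxx expr0.
  have wj : coshd (f (w 0%N)) (f (w j)) <= (2 * D) ^+ j.
    by apply: IH => i ij; apply: wadj; exact: ltnW.
  apply: le_trans (coshd_triangle _ (f (w j)) _) _.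
  rewrite exprSr mulrCA -!mulrA ler_pM2l //.
  have := coshd_ge1 (f (w j)) (f (w j.+1)).
  have := coshd_ge1 (f (w 0%N)) (f (w j)).
  move=> u1 v1; apply: ler_pM wj (adjD _ _ (wadj j _)) => //; lra.
move=> [P [TP [z Az zP] [i Pix]]]; exists z => //.
by rewrite -Pix; apply: (HD P) => //; exact: hull_vertex.
Qed.

(** Going from a point of a plane set to a vertex of its tube and along [L]
    edges multiplies [coshd] by a bounded factor, so a separation [K] of the
    plane sets that is large enough in terms of [L] survives in the graph. *)
Lemma tubes_far L : exists2 K : R, 1 <= K & forall A B,
  (forall z z', A z -> B z' -> K < coshd z z') ->
  forall x y, tube A x -> tube B y -> ~ dist_le x y L.
Proof.
have [D D1 [distD tubeD]] := coshd_distortion.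
exists ((2 * D) ^+ L.+2); first by apply: exprn_ege1; lra.
move=> A B AB x y /tubeD[z Az zx] /tubeD[z' Bz' z'y] /distD xy.
have := AB _ _ Az Bz'; apply/negP; rewrite -leNgt.
apply: le_trans (coshd_triangle _ (f y) _) _.
have := coshd_triangle z (f x) (f y); rewrite (coshdC (f y)).
have := coshd_ge1 z (f y); have := coshd_ge1 z' (f y).
have := coshd_ge1 z (f x); have := coshd_ge1 (f x) (f y).
rewrite !exprSr; move: xy zx z'y; set X := (2 * D) ^+ L.
set u := coshd z (f x); set v := coshd (f x) (f y); set w := coshd z (f y).
set r := coshd z' (f y) => vX uD rD v1 u1 r1 w1 wuv.
have uv : u * v <= D * X by apply: ler_pM => //; lra.
have wr : w * r <= (2 * (D * X)) * D by apply: ler_pM => //; lra.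
lra.
Qed.

End TilingGraph.

(** * Grids in the tiling graph *)

(** The distance of the horizontal lines at log-heights [h] and [k] is
    [`|h - k|], attained on a vertical line; [1 + t <= expR t] bounds its
    hyperbolic cosine from below. *)
Lemma uhp_rows_far (R : realType) (K a b h k : R) : 2 * K <= `|h - k| ->
  K < coshd (uhp a h) (uhp b k).
Proof.
move=> hk; rewrite coshd_uhp.
have ab : 0 <= (a - b) ^+ 2 * (expR (- h) * expR (- k)).
  by rewrite mulr_ge0 ?sqr_ge0 // mulr_ge0 // expR_ge0.
have e1 := expR_ge1Dx (h - k); have e2 := expR_ge1Dx (k - h).
have p1 := expR_gt0 (h - k); have p2 := expR_gt0 (k - h).
by move: hk; rewrite ler_normr => /orP[] hk; lra.
Qed.

(** Vertical lines approach each other as they rise, so the spacing that keeps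
    them apart depends on the top height [expR Z] that is reached. *)
Lemma uhp_columns_far (R : realType) (K Z a b h k : R) : 1 <= K ->
  h <= Z -> k <= Z -> 2 * K * expR Z <= `|a - b| ->
  K < coshd (uhp a h) (uhp b k).
Proof.
move=> K1 hZ kZ ab; rewrite coshd_uhp.
have Z0 := expR_gt0 Z.
have eZ t : t <= Z -> (expR Z)^-1 <= expR (- t).
  by move=> tZ; rewrite -expRN ler_expR lerN2.
have p1 := expR_gt0 (h - k); have p2 := expR_gt0 (k - h).
have : (2 * K) ^+ 2 <= (a - b) ^+ 2 * (expR (- h) * expR (- k)).
  rewrite -(real_normK (num_real (a - b))).
  have -> : (2 * K) ^+ 2 = (2 * K * expR Z) ^+ 2 * ((expR Z)^-1 * (expR Z)^-1).
    by field; exact: lt0r_neq0.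
  apply: ler_pM; rewrite ?sqr_ge0 ?mulr_ge0 ?invr_ge0 ?expR_ge0 //.
    by rewrite ler_sqr ?nnegrE // ?normr_ge0 // mulr_ge0 ?expR_ge0 //; lra.
  by apply: ler_pM; rewrite ?invr_ge0 ?expR_ge0 // eZ.
by rewrite expr2; nra.
Qed.

Lemma ord_far (R : realType) n (s : R) (i j : 'I_n) : 0 <= s -> i != j ->
  s <= `|i%:R * s - j%:R * s|.
Proof.
move=> s0 ij; rewrite -mulrBl normrM (ger0_norm s0) ler_peMl //.
rewrite -[i%:R]/((i%:Z)%:~R) -[j%:R]/((j%:Z)%:~R) -intrB -intr_norm ler1z.
by rewrite -gtz0_ge1 normr_gt0 subr_eq0.
Qed.

Section GridInTiling.
Variable R : realType.
Variables (p q : nat) (T : set ('I_p -> hplane R)).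
Hypotheses (p3 : (3 <= p)%N) (tilingT : regular_tiling q T).
Variables (G : graph) (f : G -> hplane R).
Hypotheses (f_range : range f = [set x | tiling_vertex T x])
  (f_inj : injective f)
  (adjE : forall a b : G, adj a b <-> tiling_edge T (f a) (f b)).

(** Rows are tubes of horizontal segments and columns are tubes of vertical
    segments in the upper half-plane. The vertical spacing [H] of the rows is
    fixed first; it determines the height of the grid, hence the horizontal
    spacing [W] of the columns. Row and column tubes meet at the vertices of a
    tile containing the point where the two segments cross. *)
Lemma tiling_graph_grid n L :
  exists (b : 'I_n -> 'I_n -> G) (C D : 'I_n -> set G),
  [/\ forall i j j', joined (C i) (b i j) (b i j'),
      forall i i' j, joined (D j) (b i j) (b i' j),
      far_apart C L & far_apart D L].
Proof.
have [K K1 far] := tubes_far tilingT adjE (L + L).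
pose H := 2 * K; pose Z := n%:R * H.
have H0 : 0 <= H by rewrite /H; lra.
pose W := 2 * K * expR Z.
have W0 : 0 <= W by rewrite mulr_ge0 ?expR_ge0 //; lra.
pose row (i : 'I_n) (a : R) := uhp a (i%:R * H).
pose col (j : 'I_n) (h : R) := uhp (j%:R * W) h.
have mem (i : 'I_n) (s : R) : 0 <= s -> `[0, n%:R * s]%classic (i%:R * s).
  move=> s0; rewrite /= in_itv /= mulr_ge0 ?ler0n //= ler_wpM2r // ler_nat.
  exact: ltnW.
pose rowA i := row i @` `[0, n%:R * W]; pose colA j := col j @` `[0, Z].
have /choice[b bP] : forall ij : 'I_n * 'I_n, exists x, exists P, exists k,
    [/\ T P, hull P (uhp (ij.2%:R * W) (ij.1%:R * H)) & P k = f x].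
  move=> [i j].
  have [P TP Pij] := tile_cover tilingT (uhp (j%:R * W) (i%:R * H)).
  pose k := first_index p3; have [x fx] := vertex_of_tile f_range k TP.
  by exists x, P, k.
exists (fun i j => b (i, j)).
exists (fun i => tube T f (rowA i)), (fun j => tube T f (colA j)).
split.
- move=> i j j'; have [P [k [TP Pp Pk]]] := bP (i, j).
  have [P' [k' [TP' Pp' Pk']]] := bP (i, j').
  apply: (tube_joined p3 tilingT f_range f_inj adjE (g := row i) (s := j%:R * W)
    (t := j'%:R * W) _ TP TP' _ _ Pp Pp' Pk Pk').
  + by apply: uhp_continuous => t; [exact: cvg_id|exact: cvg_cst].
  + exact: mem.
  + exact: mem.
- move=> i i' j; have [P [k [TP Pp Pk]]] := bP (i, j).
  have [P' [k' [TP' Pp' Pk']]] := bP (i', j).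
  apply: (tube_joined p3 tilingT f_range f_inj adjE (g := col j) (s := i%:R * H)
    (t := i'%:R * H) _ TP TP' _ _ Pp Pp' Pk Pk').
  + by apply: uhp_continuous => t; [exact: cvg_cst|exact: cvg_id].
  + exact: mem.
  + exact: mem.
- move=> i i' x x' Cx Cx' xx'; apply/eqP; apply: contrapT => /negP ii'.
  apply: (far _ _ _ _ _ Cx Cx' xx') => _ _ [a _ <-] [a' _ <-].
  by apply: uhp_rows_far; exact: ord_far.
- move=> i i' x x' Cx Cx' xx'; apply/eqP; apply: contrapT => /negP ii'.
  apply: (far _ _ _ _ _ Cx Cx' xx') => _ _ [h + <-] [h' + <-].
  rewrite /= !in_itv /= => /andP[_ hZ] /andP[_ hZ'].
  by apply: (uhp_columns_far K1 hZ hZ'); exact: ord_far.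
Qed.

End GridInTiling.

Theorem corollary9 (R : realType) (G : graph) (hG : hyperbolic_tiling_graph R G) :
  wCop G = Infty.
Proof.
have [p [q [T [p3 _ _ tilingT [f [f_inj f_range adjE]]]]]] := hG.
apply: wCop_Infty => n [sigma sigma0 [rho win]].
have [b [C [D [Cj Dj sC sD]]]] :=
  tiling_graph_grid p3 tilingT f_range f_inj adjE n.+1 (rho + sigma).
have [psi [rad [psi0 rad0]]] := grid_not_CopWin Cj Dj sC sD.
by apply; exact: win.
Qed.
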